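(* Let $X$ and $U$ be non-trivial complex Hilbert spaces with $\dim U=1$, where $U$ is identified with $\mathbb C$. Let $A_s\in\mathcal L(X)$ and $B_s\in\mathcal L(U,X)$, and let $x_1=(x_1(k))_{k\in\mathbb N}$, $x_0=(x_0(k))_{k\in\mathbb N}$ be Bessel sequences in $X$ and $u_0=(u_0(k))_{k\in\mathbb N}$ a Bessel sequence in $U$ (equivalently, $u_0\in\ell^2(\mathbb N)$) such that $x_1(k)=A_sx_0(k)+B_su_0(k)$ for all $k\in\mathbb N$. Let $\Xi_1,\Xi_0\in\mathcal L(\ell^2(\mathbb N),X)$ and $\Upsilon_0\in\mathcal L(\ell^2(\mathbb N),U)$ be the synthesis operators associated with $x_1,x_0,u_0$, respectively. Assume either that $\operatorname{Ker}\Xi_0\setminus\{u_0\}^{\perp}\ne\emptyset$, where $\{u_0\}^\perp$ is the orthogonal complement of $\{u_0\}$ in $\ell^2(\mathbb N)$, or that the data $(x_1,x_0,u_0)$ are not informative for system identification. Then for a fixed $\gamma\in(0,1)$, the data $(x_1,x_0,u_0)$ are informative for stabilization with decay rate $\gamma$ if and only if the following holds: $\overline{\operatorname{Ran}\Xi_0}=X$, and there exists a densely defined linear operator $\Xi_0^\dagger$ from $X$ to $\ell^2(\mathbb N)$ with domain $D(\Xi_0^\dagger)=\operatorname{Ran}\Xi_0$ such that a) $\Xi_0\Xi_0^\dagger x=x$ for all $x\in D(\Xi_0^\dagger)$; b) $\Upsilon_0\Xi_0^\dagger$ can be extended to an operator in $\mathcal L(X,U)$; and c) $\Xi_1\Xi_0^\dagger$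 can be extended to an operator in $\mathcal L(X)$, and this extension is power stable with decay rate $\gamma$.
   Context: $\mathcal L(Y,Z)$ denotes the bounded linear operators from $Y$ to $Z$, $\mathcal L(Y)=\mathcal L(Y,Y)$; $\operatorname{Ran}$ and $\operatorname{Ker}$ denote range and kernel; $\mathbb N=\{1,2,\dots\}$, $\mathbb N_0=\mathbb N\cup\{0\}$. A sequence $(\eta_k)_{k\in\mathbb N}$ in a Hilbert space $Y$ is a Bessel sequence if there is $\alpha>0$ with $\sum_{k=1}^\infty|\langle y,\eta_k\rangle|^2\le\alpha\|y\|^2$ for all $y\in Y$. Its synthesis operator is the bounded operator $\ell^2(\mathbb N)\to Y$, $w=(w_k)_{k\in\mathbb N}\mapsto\sum_{k=1}^\infty w_k\eta_k$. A sequence in $\mathbb C$ is a Bessel sequence if and only if it belongs to $\ell^2(\mathbb N)$, so, with $U$ identified with $\mathbb C$, $u_0$ is an element of $\ell^2(\mathbb N)$ and $\{u_0\}^\perp=\{w\in\ell^2(\mathbb N):\langle w,u_0\rangle=0\}$. For $\gamma\in(0,1)$, a bounded operator $F$ is power stable with decay rate $\gamma$ if there is $M\ge1$ with $\|F^k\|\le M\gamma^k$ for all $k\in\mathbb N_0$. Define $\Sigma_{\mathrm{is}}:=\{(A,B)\in\mathcal L(X)\times\mathcal L(U,X): x_1(k)=Ax_0(k)+Bu_0(k)\ \text{for all }k\in\mathbb N\}$, and for $K\in\mathcal L(X,U)$, $M\ge1$, $\gamma>0$, $\Sigma_{K,M,\gamma}:=\{(A,B)\in\mathcal L(X)\times\mathcal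 L(U,X):\|(A+BK)^k\|\le M\gamma^k\ \text{for all }k\in\mathbb N_0\}$. The data are informative for system identification if $\Sigma_{\mathrm{is}}=\{(A_s,B_s)\}$. For $\gamma\in(0,1)$, the data are informative for stabilization with decay rate $\gamma$ if there exist $K\in\mathcal L(X,U)$ and $M\ge1$ with $\Sigma_{\mathrm{is}}\subseteq\Sigma_{K,M,\gamma}$.
   Formalization: In forming {u_0}^⊥, u_0 is replaced by its complex conjugate sequence, so that {u_0}^⊥ = Ker Υ_0; with the literal u_0 the claim fails for some non-real u_0 (the two agree for real u_0). *)

(* Defs.v *)
From HB Require Import structures.
From mathcomp Require Import all_boot all_order all_algebra sesquilinear.
From mathcomp Require Import all_classical all_reals all_analysis.
From mathcomp Require Import complex ring.

Set Implicit Arguments.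
Unset Strict Implicit.
Unset Printing Implicit Defensive.

Import Order.TTheory GRing.Theory Num.Theory.
Import numFieldNormedType.Exports.

Local Open Scope classical_set_scope.
Local Open Scope ring_scope.

(* The complex field is R[i] for R : realType. Sequences indexed by
   {1, 2, ...} in the mathematics are indexed by nat = {0, 1, ...} here. *)

(* The form is linear in its first argument, conjugate-linear in the second. *)
HB.mixin Record NormedModule_isHilbert (R : realType) V
    & CompleteNormedModule R[i] V := {
  inner : {dot V for (@Num.conj R[i])};
  inner_normE : forall x : V, inner x x = `|x| ^+ 2
}.

#[short(type="hilbertType")]
HB.structure Definition Hilbert (R : realType) :=
  {V of CompleteNormedModule R[i] V & NormedModule_isHilbert R V}.

(* The norm of a module over R[i] takes its values in R[i]; this is the same
   norm as an element of R. *)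
Definition rnorm (R : realType) (V : normedZmodType R[i]) (x : V) : R :=
  complex.Re `|x|.

Section l2.
Variable R : realType.

Definition l2_pred : {pred nat -> R[i]^o} :=
  [pred w | `[< (\sum_(0 <= k <oo) (rnorm (w k) ^+ 2)%:E < +oo)%E >]].

Lemma rnormM (z w : R[i]) : rnorm (z * w) = rnorm z * rnorm w.
Proof. by rewrite /rnorm normrM !normc_def -rmorphM. Qed.

Lemma rnorm_ge0 (z : R[i]) : 0 <= rnorm z.
Proof. by rewrite /rnorm normc_def /= sqrtr_ge0. Qed.

Lemma rnormD (z w : R[i]) : rnorm (z + w) <= rnorm z + rnorm w.
Proof. by have := ler_normD z w; rewrite /rnorm !normc_def -rmorphD lecR. Qed.

Let sqrD_le (p q : R) : (p + q) ^+ 2 <= 2 * p ^+ 2 + 2 * q ^+ 2.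
Proof.
by rewrite -subr_ge0 (_ : _ - _ = (p - q) ^+ 2) ?sqr_ge0//; ring.
Qed.

Lemma l2_submod_closed : submod_closed l2_pred.
Proof.
split.
  rewrite unfold_in; apply/asboolP; rewrite eseries0 ?ltry// => k _ _.
  by rewrite /rnorm normr0 expr0n.
move=> a u v; rewrite !unfold_in => /asboolP su /asboolP sv; apply/asboolP.
have le k : xpredT k ->
    ((rnorm ((a *: u + v) k) ^+ 2)%:E <=
     (2 * rnorm a ^+ 2)%:E * (rnorm (u k) ^+ 2)%:E +
     2%:E * (rnorm (v k) ^+ 2)%:E)%E.
  move=> _; rewrite -!EFinM -EFinD lee_fin.
  have h : rnorm ((a *: u + v) k) <= rnorm a * rnorm (u k) + rnorm (v k).
    by have := rnormD (a * u k) (v k); rewrite rnormM.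
  set p := rnorm a * _ in h; set q := rnorm (v k) in h *.
  have -> : 2 * rnorm a ^+ 2 * rnorm (u k) ^+ 2 = 2 * p ^+ 2.
    by rewrite /p exprMn; ring.
  have p0 : 0 <= p by rewrite mulr_ge0 ?rnorm_ge0.
  have q0 : 0 <= q by exact: rnorm_ge0.
  have r0 : 0 <= rnorm ((a *: u + v) k) by exact: rnorm_ge0.
  apply: le_trans (_ : (p + q) ^+ 2 <= _); first by rewrite lerXn2r ?nnegrE ?addr_ge0.
  exact: sqrD_le.
apply: le_lt_trans (lee_nneseries _ le) _.
  by move=> k _ _; rewrite lee_fin sqr_ge0.
have c0 : 0 <= 2 * rnorm a ^+ 2 by rewrite mulr_ge0 ?sqr_ge0.
rewrite nneseriesD; last 2 first.
- by move=> k _ _; rewrite -EFinM lee_fin mulr_ge0 ?sqr_ge0.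
- by move=> k _ _; rewrite -EFinM lee_fin mulr_ge0 ?sqr_ge0.
rewrite !nneseriesZl//; last 2 first.
- by move=> k _; rewrite lee_fin sqr_ge0.
- by move=> k _; rewrite lee_fin sqr_ge0.
by rewrite lte_add_pinfty// lte_mul_pinfty// lee_fin.
Qed.

HB.instance Definition _ :=
  GRing.isSubmodClosed.Build R[i] (nat -> R[i]^o) l2_pred l2_submod_closed.

Record l2 := L2 { l2_val :> nat -> R[i]^o ; _ : l2_val \in l2_pred }.

HB.instance Definition _ := [isSub for l2_val].
HB.instance Definition _ := [Choice of l2 by <:].
HB.instance Definition _ := [SubChoice_isSubLmodule of l2 by <:].

Definition l2_inner (w v : l2) : R[i]^o :=
  limn (series (fun k => w k * (v k)^* : R[i]^o)).

Definition l2_orthocompl (S : set l2) : set l2 :=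
  [set w | forall v, S v -> l2_inner w v = 0].

End l2.

Section operators.
Variable R : realType.
Implicit Types Y Z : normedModType R[i].

(* {linear Y -> Z} together with bounded_op is the space L(Y, Z). *)
Definition bounded_op Y Z (F : Y -> Z) : Prop :=
  exists C : R, forall y, rnorm (F y) <= C * rnorm y.

Definition opnorm Y Z (F : Y -> Z) : R :=
  sup [set rnorm (F y) | y in [set y : Y | rnorm y <= 1]].

Definition power_stable Y (gamma : R) (F : Y -> Y) : Prop :=
  exists2 M : R, 1 <= M & forall k, opnorm (iter k F) <= M * gamma ^+ k.

End operators.

(* A linear operator from Y to Z with domain D(T) = pdom T, a subspace of Y;
   the values of pfun T outside pdom T are irrelevant. *)
Record partial_op (K : pzRingType) (Y Z : lmodType K) := PartialOp {
  pdom : set Y;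
  pfun : Y -> Z;
  pdom0 : pdom 0;
  pdomP : forall a x y, pdom x -> pdom y -> pdom (a *: x + y);
  pfunP : forall a x y, pdom x -> pdom y ->
    pfun (a *: x + y) = a *: pfun x + pfun y
}.

Definition densely_defined (R : realType) (Y : normedModType R[i])
    (Z : lmodType R[i]) (T : partial_op Y Z) : Prop :=
  closure (pdom T) = setT.

Section data.
Variable R : realType.

Definition bessel (Y : hilbertType R) (eta : nat -> Y) : Prop :=
  exists2 alpha : R, 0 < alpha & forall y : Y,
    (\sum_(0 <= k <oo) (rnorm (inner y (eta k)) ^+ 2)%:E <=
     (alpha * rnorm y ^+ 2)%:E)%E.

Definition synthesis (Y : hilbertType R) (eta : nat -> Y) (w : l2 R) : Y :=
  limn (series (fun k => w k *: eta k)).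

Definition Ker (Y : hilbertType R) (Xi : l2 R -> Y) : set (l2 R) :=
  [set w | Xi w = 0].

(* A Bessel sequence u in a one-dimensional space U = span e, |e| = 1, viewed
   as an element v of l2. The identification is the one that makes
     synthesis u w = l2_inner w v *: e,
   i.e. v is the vector representing the functional synthesis u, so that the
   orthogonal complement of v is the kernel of synthesis u. For U = C and e = 1
   it reads v k = (u k)^*. Pitfall: with the coordinates inner (u k) e, without
   the conjugation, the orthogonal complement would be the kernel of the
   synthesis operator of the conjugate sequence, and a vector of Ker (synthesis
   x0) outside it would give no information on synthesis u; a criterion for
   stabilization based on it would be false. *)
Definition l2_of_seq (U : hilbertType R) (e : U) (u : nat -> U) (v : l2 R) :
    Prop :=
  forall k, v k = inner e (u k).

Variables X U : hilbertType R.

Definition Sigma_is (x1 x0 : nat -> X) (u0 : nat -> U) :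
    set ({linear X -> X} * {linear U -> X}) :=
  [set AB : {linear X -> X} * {linear U -> X} |
     [/\ bounded_op AB.1, bounded_op AB.2 &
         forall k, x1 k = AB.1 (x0 k) + AB.2 (u0 k)]].

Definition Sigma_stab (K : {linear X -> U}) (M gamma : R) :
    set ({linear X -> X} * {linear U -> X}) :=
  [set AB : {linear X -> X} * {linear U -> X} |
     [/\ bounded_op AB.1, bounded_op AB.2 &
         forall k, opnorm (iter k (fun x => AB.1 x + AB.2 (K x)))
                   <= M * gamma ^+ k]].

Definition informative_identification (x1 x0 : nat -> X) (u0 : nat -> U)
    (As : {linear X -> X}) (Bs : {linear U -> X}) : Prop :=
  Sigma_is x1 x0 u0 = [set (As, Bs)].

Definition informative_stabilization (x1 x0 : nat -> X) (u0 : nat -> U)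
    (gamma : R) : Prop :=
  exists K : {linear X -> U}, bounded_op K /\
  exists2 M : R, 1 <= M & Sigma_is x1 x0 u0 `<=` Sigma_stab K M gamma.

End data.

(* Main.v *)
(** The synthesis operators satisfy Xi1 = A Xi0 + B Upsilon0 for every system
    (A, B) explaining the data. If K stabilizes all these systems uniformly and
    (A, B) solves the homogeneous equation A Xi0 + B Upsilon0 = 0, then
    As + Bs K + t (A + B K) is bounded uniformly in t, whence A + B K = 0.
    Density of Ran Xi0 follows with A = <., z> z, B = 0 for z orthogonal to
    Ran Xi0. In the non-identifiable case a nontrivial solution has B injective
    (dim U = 1), whence Upsilon0 = K Xi0 and any linear right inverse of Xi0
    works; in the other case a vector w of Ker Xi0 with Upsilon0 w != 0 is used to
    correct a right inverse E so that Upsilon0 E = K on Ran Xi0. Conversely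
    A + B K agrees with Xi1 Xi0d on the dense subspace Ran Xi0 for every (A, B)
    explaining the data, so all closed loops coincide with its extension. *)

From HB Require Import structures.
Require Import Defs.
From mathcomp Require Import all_boot all_order all_algebra sesquilinear.
From mathcomp Require Import all_classical all_reals all_analysis.
From mathcomp Require Import complex ring lra.

Set Implicit Arguments.
Unset Strict Implicit.
Unset Printing Implicit Defensive.

Import Order.TTheory GRing.Theory Num.Theory.
Import numFieldNormedType.Exports.

Local Open Scope classical_set_scope.
Local Open Scope ring_scope.

(** * Norms and limits measured by real numbers *)

Lemma rnormcE (R : realType) (z : R[i]) : `|z| = (rnorm z)%:C%C.
Proof. by rewrite /rnorm normc_def. Qed.

Section rnorm_theory.
Variables (R : realType) (V : normedModType R[i]).
Implicit Types x y : V.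

Lemma rnormE x : `|x| = (rnorm x)%:C%C.
Proof. by rewrite /rnorm RRe_real. Qed.

Lemma rnormv_ge0 x : 0 <= rnorm x.
Proof. by have := normr_ge0 x; rewrite rnormE lecR. Qed.

Lemma rnormv0 : rnorm (0 : V) = 0.
Proof. by rewrite /rnorm normr0. Qed.

Lemma rnormv_eq0 x : (rnorm x == 0) = (x == 0).
Proof. by rewrite -(normr_eq0 x) rnormE -(inj_eq (@complexI R)). Qed.

Lemma rnormvD x y : rnorm (x + y) <= rnorm x + rnorm y.
Proof. by have := ler_normD x y; rewrite !rnormE -rmorphD/= lecR. Qed.

Lemma rnormvN x : rnorm (- x) = rnorm x.
Proof. by rewrite /rnorm normrN. Qed.

Lemma rnormvZ (a : R[i]) x : rnorm (a *: x) = rnorm a * rnorm x.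
Proof.
by apply: (@complexI R); rewrite rmorphM/= -!rnormE normrZ rnormcE.
Qed.

Lemma rnorm_nat n : rnorm (n%:R : R[i]) = n%:R.
Proof. by rewrite /rnorm normr_nat -(rmorph_nat (@real_complex R)). Qed.

(** A positive element of [R[i]] is real, so testing with real [eps] loses nothing. *)
Lemma rcvgP (u : nat -> V) (l : V) :
  (u @ \oo --> l) <->
  forall eps : R, 0 < eps -> exists N, forall n, (N <= n)%N -> rnorm (l - u n) <= eps.
Proof.
split=> [/cvgrPdist_le ul eps eps0|ul].
  have /ul [N _ uN] : 0 < eps%:C%C by rewrite ltcR.
  by exists N => n /uN/=; rewrite rnormE lecR.
apply/cvgrPdist_le => eps eps0.
have epsE : eps = (complex.Re eps)%:C%C by rewrite RRe_real// gtr0_real.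
rewrite epsE ltcR in eps0.
have [N uN] := ul _ eps0.
by exists N => // n /= /uN h; rewrite epsE rnormE lecR.
Qed.

End rnorm_theory.

Lemma rcauchy_cvg (R : realType) (V : completeNormedModType R[i]) (u : nat -> V) :
  (forall eps : R, 0 < eps ->
    exists N, forall n, (N <= n)%N -> rnorm (u N - u n) <= eps) -> cvgn u.
Proof.
move=> uC; apply: cauchy_cvg; apply: cauchy_exP => eps eps0.
have epsE : eps = (complex.Re eps)%:C%C by rewrite RRe_real// gtr0_real.
rewrite epsE ltcR in eps0.
have [N uN] := uC _ (divr_gt0 eps0 (ltr0n _ 2)).
exists (u N); exists N => // n /= /uN h.
rewrite -ball_normE /= epsE rnormE ltcR (le_lt_trans h)//.
by rewrite ltr_pdivrMr// ltr_pMr// ltr1n.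
Qed.

(** * Inner products *)

Section inner_theory.
Variables (R : realType) (X : hilbertType R).
Implicit Types x y : X.

Lemma inner_rnormE x : inner x x = (rnorm x ^+ 2)%:C%C.
Proof. by rewrite inner_normE rnormE rmorphXn. Qed.

Lemma inner_conjC x y : inner x y = (inner y x)^*.
Proof. by rewrite hermC expr0 mul1r. Qed.

Lemma rnorm_sqr_conjC (z : R[i]) : z * z^* = (rnorm z ^+ 2)%:C%C.
Proof. by rewrite -normCK (rnormE (z : R[i]^o)) rmorphXn. Qed.

Lemma innerZl a x y : inner (a *: x) y = a * inner x y.
Proof. exact: linearZl_LR. Qed.

Lemma innerZr a x y : inner x (a *: y) = a^* * inner x y.
Proof. exact: linearZr_LR. Qed.

Lemma innerDl x y z : inner (x + y) z = inner x z + inner y z.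
Proof. exact: linearDl. Qed.

Lemma innerBl x y z : inner (x - y) z = inner x z - inner y z.
Proof. exact: linearBl. Qed.

Lemma innerBr x y z : inner x (y - z) = inner x y - inner x z.
Proof. exact: linearBr. Qed.

Lemma innerDr x y z : inner x (y + z) = inner x y + inner x z.
Proof. exact: linearDr. Qed.

(** Pythagoras for the projection onto the line of [y]. Nonnegativity of the left side gives
    Cauchy-Schwarz; the exact value serves the minimal distance argument below. *)
Lemma rnorm_sub_proj x y : y != 0 ->
  rnorm (x - (inner x y / inner y y) *: y) ^+ 2 =
  rnorm x ^+ 2 - rnorm (inner x y) ^+ 2 / rnorm y ^+ 2.
Proof.
move=> y0; apply: (@complexI R).
have n0 : (rnorm y ^+ 2)%:C%C != 0 :> R[i].
  by rewrite (inj_eq (@complexI R)) expf_eq0 rnormv_eq0 (negbTE y0) andbF.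
rewrite -inner_rnormE rmorphB fmorph_div/= -!inner_rnormE -rnorm_sqr_conjC.
set a := inner x y; set b := inner y y.
have bE : b^* = b by rewrite /b -inner_conjC.
rewrite innerBl !innerBr !innerZl !innerZr -/a -/b (inner_conjC y x) -/a.
rewrite rmorphM/= fmorphV/= bE.
have b0 : b != 0 by rewrite /b inner_rnormE.
by field.
Qed.

Lemma Cauchy_Schwarz x y : rnorm (inner x y) <= rnorm x * rnorm y.
Proof.
have [->|y0] := eqVneq y 0.
  by rewrite linear0r rnormv0 mulr0 /rnorm normr0.
rewrite -(ler_pXn2r (ltn0Sn 1)) ?nnegrE ?mulr_ge0 ?rnormv_ge0 ?rnorm_ge0//.
  rewrite exprMn -ler_pdivrMr.
    by rewrite -subr_ge0 -rnorm_sub_proj// sqr_ge0.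
  by rewrite exprn_gt0// lt_neqAle rnormv_ge0 eq_sym rnormv_eq0 y0.
Qed.

Lemma parallelogram x y :
  rnorm (x + y) ^+ 2 + rnorm (x - y) ^+ 2 = 2 * rnorm x ^+ 2 + 2 * rnorm y ^+ 2.
Proof.
have E (z : R) : (2 * z)%:C%C = 2 * z%:C%C.
  by rewrite rmorphM/= -(rmorph_nat (@real_complex R)).
apply: (@complexI R); rewrite !rmorphD/= !E -!inner_rnormE.
by rewrite !(innerBl, innerDl, innerBr, innerDr); ring.
Qed.

End inner_theory.

(** Informativity for identification compares bundled maps; their linearity proofs agree by proof
    irrelevance. *)
Lemma linear_extP (R : pzRingType) (V W : lmodType R) (F G : {linear V -> W}) :
  F =1 G -> F = G.
Proof.
case: F G => [f [[af] [sf]]] [g [[ag] [sg]]] /= /funext fg.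
rewrite fg in af sf *; rewrite (Prop_irrelevance af ag) (Prop_irrelevance sf sg).
by [].
Qed.

Lemma linear_bundle (R : pzRingType) (V W : lmodType R) (f : V -> W) :
  linear f -> exists F : {linear V -> W}, F =1 f.
Proof.
move=> fl; pose m := GRing.isLinear.Build _ _ _ _ f fl.
pose F : {linear V -> W} := HB.pack f m.
by exists F.
Qed.

(** * Bounded operators, density and the operator norm *)

Section bounded_operators.
Variables (R : realType).
Implicit Types Y Z : normedModType R[i].

Lemma bounded_op_pos Y Z (F : Y -> Z) : bounded_op F ->
  exists2 C : R, 0 < C & forall y, rnorm (F y) <= C * rnorm y.
Proof.
move=> [C FC]; exists (`|C| + 1) => [|y]; first by rewrite ltr_wpDl.
rewrite (le_trans (FC y))// ler_wpM2r ?rnormv_ge0//.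
by rewrite (le_trans (ler_norm C))// lerDl.
Qed.

Lemma bounded_op_cvg Y Z (F : {linear Y -> Z}) (u : nat -> Y) (l : Y) :
  bounded_op F -> u @ \oo --> l -> (fun n => F (u n)) @ \oo --> F l.
Proof.
move=> /bounded_op_pos[C C0 FC] /rcvgP ul; apply/rcvgP => eps eps0.
have [N uN] := ul _ (divr_gt0 eps0 C0).
exists N => n /uN h; rewrite -linearB (le_trans (FC _))//.
by rewrite mulrC -ler_pdivlMr.
Qed.

Lemma closure_rnormP Y (S : set Y) (l : Y) :
  closure S l <->
  forall eps : R, 0 < eps -> exists2 s, S s & rnorm (l - s) < eps.
Proof.
split=> [cl eps eps0|h B /nbhs_ballP[eps /= eps0 epsB]].
  have : nbhs l (ball l eps%:C%C) by apply: nbhsx_ballx; rewrite ltcR.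
  move=> /cl [s []]; rewrite -ball_normE /= rnormE ltcR => Ss sl.
  by exists s.
have epsE : eps = (complex.Re eps)%:C%C by rewrite RRe_real// gtr0_real.
have /h[s Ss sl] : 0 < complex.Re eps by rewrite -ltcR -epsE.
by exists s; split=> //; apply: epsB; rewrite -ball_normE /= rnormE epsE ltcR.
Qed.

Lemma bounded_op_dense_eq0 Y Z (S : set Y) (F : {linear Y -> Z}) :
  closure S = setT -> bounded_op F -> (forall y, S y -> F y = 0) ->
  forall y, F y = 0.
Proof.
move=> Sd /bounded_op_pos[C C0 FC] F0 y.
apply/eqP; rewrite -rnormv_eq0 eq_le rnormv_ge0 andbT.
apply/ler_addgt0Pl => eps eps0; rewrite addr0.
have /closure_rnormP/(_ _ (divr_gt0 eps0 C0))[s Ss sl] : closure S y by rewrite Sd.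
rewrite -[F y]subr0 -(F0 _ Ss) -linearB (le_trans (FC _))//.
by rewrite mulrC -ler_pdivlMr// ltW.
Qed.

Lemma opnorm_ge Y Z (F : {linear Y -> Z}) (y : Y) : bounded_op F ->
  rnorm (F y) <= opnorm F * rnorm y.
Proof.
move=> /bounded_op_pos[C C0 FC].
have [->|y0] := eqVneq y 0; first by rewrite linear0 !rnormv0 mulr0.
have ny : 0 < rnorm y by rewrite lt_neqAle rnormv_ge0 eq_sym rnormv_eq0 y0.
have nyE : rnorm ((rnorm y)^-1%:C%C : R[i]) = (rnorm y)^-1.
  by apply: (@complexI R); rewrite -rnormcE ger0_norm// lecR invr_ge0 ltW.
rewrite -ler_pdivrMr// mulrC -nyE -rnormvZ -linearZ.
apply: ub_le_sup.
  exists C => _ [z /= z1 <-]; rewrite (le_trans (FC z))//.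
  by rewrite ler_piMr// ltW.
by exists ((rnorm y)^-1%:C%C *: y) => //=; rewrite rnormvZ nyE mulVf// gt_eqF.
Qed.

End bounded_operators.

(** * Bessel sequences and synthesis operators *)

Section synthesis_theory.
Variables (R : realType) (Y : hilbertType R).
Implicit Types (eta : nat -> Y) (w : l2 R).

Lemma bessel_sum eta : bessel eta ->
  exists2 alpha : R, 0 < alpha & forall y m n,
    \sum_(m <= k < n) rnorm (inner y (eta k)) ^+ 2 <= alpha * rnorm y ^+ 2.
Proof.
move=> [alpha alpha0 eta_le]; exists alpha => // y m n.
rewrite -lee_fin (le_trans _ (eta_le y))//.
have ge0 k : (0 <= (rnorm (inner y (eta k)) ^+ 2)%:E :> \bar R)%E.
  by rewrite lee_fin sqr_ge0.
rewrite (le_trans _ (nneseries_lim_ge n _))// sumEFin lee_fin.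
have [nm|/ltnW mn] := leqP n m.
  by rewrite big_geq// sumr_ge0// => k _; rewrite sqr_ge0.
rewrite (@big_cat_nat _ _ _ m 0 n)//= lerDr sumr_ge0// => k _.
by rewrite sqr_ge0.
Qed.

Lemma l2_tail w (eps : R) : 0 < eps ->
  exists N, forall n, (N <= n)%N -> \sum_(N <= k < n) rnorm (w k) ^+ 2 <= eps.
Proof.
move=> eps0.
have /asboolP w_fin : (w : nat -> R[i]^o) \in @l2_pred R by case: w.
have ge0 k : (0 <= (rnorm (w k) ^+ 2)%:E :> \bar R)%E by rewrite lee_fin sqr_ge0.
pose u := series (fun k => rnorm (w k) ^+ 2).
have u_cvg : cvgn u.
  apply: nondecreasing_is_cvgn.
    apply/nondecreasing_seqP => n.
    by rewrite /u /series/= big_nat_recr//= lerDl sqr_ge0.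
  exists (fine (\sum_(0 <= k <oo) (rnorm (w k) ^+ 2)%:E)%E) => _ [n _ <-].
  rewrite -lee_fin fineK; last first.
    by rewrite ge0_fin_numE// nneseries_ge0// => k _ _.
  by rewrite /u /series/= -sumEFin nneseries_lim_ge.
have [[A B] [[N1 _ AN] [N2 _ BN]] h] :=
  (cauchy_seriesP _).1 (cvg_cauchy _ u_cvg) _ eps0.
(* The Cauchy criterion holds on a product of two sets; past the larger threshold the pair (start,
   end) lies in it. *)
exists (maxn N1 N2) => n Nn.
have /h/= : (A `*` B) (maxn N1 N2, n).
  split => /=; [apply: AN|apply: BN] => /=; first exact: leq_maxl.
  by rewrite (leq_trans _ Nn)// leq_maxr.
by move=> /ltW; apply: le_trans; exact: ler_norm.
Qed.

(** Pairing the sum S with itself gives |S|^2 <= sum |w_k| |<S, eta_k>|; a weighted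
    arithmetic-geometric inequality and the Bessel bound then absorb half of |S|^2. *)
Lemma bessel_sum_le eta : bessel eta ->
  exists2 alpha : R, 0 < alpha & forall w m n,
    rnorm (\sum_(m <= k < n) w k *: eta k) ^+ 2 <=
    alpha * \sum_(m <= k < n) rnorm (w k) ^+ 2.
Proof.
move=> /bessel_sum[alpha alpha0 eta_le]; exists alpha => // w m n.
set S := \sum_(m <= k < n) w k *: eta k.
have SS : rnorm S ^+ 2 <= \sum_(m <= k < n) rnorm (w k) * rnorm (inner S (eta k)).
  have -> : rnorm S ^+ 2 = rnorm (inner S S).
    by apply: (@complexI R); rewrite -rnormcE -inner_rnormE ger0_norm//
      inner_rnormE lecR sqr_ge0.
  have -> : inner S S = \sum_(m <= k < n) w k * inner (eta k) S.
    rewrite {1}/S; elim/big_rec2: _ => [|k a b _ IH]; first by rewrite linear0l.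
    by rewrite innerDl innerZl -IH.
  elim/big_rec2: _ => [|k a b _ IH]; first by rewrite /rnorm normr0.
  rewrite (le_trans (rnormD _ _))// lerD// rnormM (inner_conjC S) /rnorm.
  by rewrite norm_conjC.
(* With the weight [alpha], the Bessel bound makes the second terms sum to at most |S|^2 / 2. *)
have AG k : rnorm (w k) * rnorm (inner S (eta k)) <=
    2^-1 * (alpha * rnorm (w k) ^+ 2 + alpha^-1 * rnorm (inner S (eta k)) ^+ 2).
  set a := rnorm (w k); set b := rnorm (inner _ _).
  rewrite -subr_ge0.
  have -> : 2^-1 * (alpha * a ^+ 2 + alpha^-1 * b ^+ 2) - a * b =
      2^-1 * alpha * (a - alpha^-1 * b) ^+ 2 by field; rewrite gt_eqF.
  by rewrite mulr_ge0 ?sqr_ge0// mulr_ge0 ?invr_ge0 ?ltW.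
have := le_trans SS (ler_sum _ (fun k _ => AG k)).
rewrite -mulr_sumr big_split/= -!mulr_sumr => h.
have h2 : alpha^-1 * \sum_(m <= i < n) rnorm (inner S (eta i)) ^+ 2 <= rnorm S ^+ 2.
  by rewrite mulrC ler_pdivrMr// mulrC.
lra.
Qed.

Lemma synthesis_cvg eta w : bessel eta ->
  series (fun k => w k *: eta k) @ \oo --> synthesis eta w.
Proof.
move=> /bessel_sum_le[alpha alpha0 sum_le].
suff : cvgn (series (fun k => w k *: eta k)) by [].
apply: rcauchy_cvg => eps eps0.
have [N wN] := l2_tail w (divr_gt0 (exprn_gt0 2 eps0) alpha0).
exists N => n Nn; rewrite -rnormvN opprB sub_series Nn.
rewrite -(ler_pXn2r (ltn0Sn 1)) ?nnegrE ?rnormv_ge0 ?(ltW eps0)//.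
by rewrite (le_trans (sum_le _ _ _))// mulrC -ler_pdivlMr// wN.
Qed.

Lemma synthesis_linear eta : bessel eta -> linear (synthesis eta).
Proof.
move=> eta_b a v w; apply: cvg_lim; first exact: norm_hausdorff.
have -> : series (fun k => (a *: v + w) k *: eta k) =
    fun n => a *: series (fun k => v k *: eta k) n + series (fun k => w k *: eta k) n.
  apply/funext => n; rewrite /series/= scaler_sumr -big_split/=.
  by apply: eq_bigr => k _; rewrite scalerDl scalerA.
by apply: cvgD; [apply: cvgZl_tmp|]; exact: synthesis_cvg.
Qed.

(** The unit vectors of l2 place each term of a sequence in the range of its synthesis operator. *)
Definition delta_seq (k : nat) : nat -> R[i]^o := fun j => (j == k)%:R.

Lemma delta_l2 k : delta_seq k \in @l2_pred R.
Proof.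
rewrite unfold_in; apply/asboolP; rewrite (nneseries_split 0 k.+1)//; last first.
  by move=> j _; rewrite lee_fin sqr_ge0.
rewrite [X in (_ + X)%E]eseries0 ?adde0 ?sumEFin ?ltry// => j kj _.
by rewrite /delta_seq gtn_eqF// /rnorm normr0 expr0n.
Qed.

Lemma synthesis_delta eta k : synthesis eta (L2 (delta_l2 k)) = eta k.
Proof.
apply: cvg_lim; first exact: norm_hausdorff.
(* [series] at n sums the indices below n, so the term k is present from n = k + 1 on. *)
apply/rcvgP => eps eps0; exists k.+1 => n kn.
rewrite /series/= big_mkord (bigD1 (Ordinal kn))//= big1 => [|j].
  by rewrite /delta_seq eqxx scale1r addr0 subrr rnormv0 ltW.
by rewrite -val_eqE /= /delta_seq => /negbTE ->; rewrite scale0r.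
Qed.

End synthesis_theory.

(** Bounded operators pass through the limits of partial sums; convergence of the series for [z] is
    inherited from those for [x] and [u]. *)
Lemma synthesis_comb (R : realType) (X U Z : hilbertType R)
    (A : {linear X -> Z}) (B : {linear U -> Z})
    (x : nat -> X) (u : nat -> U) (z : nat -> Z) (w : l2 R) :
  bounded_op A -> bounded_op B -> bessel x -> bessel u ->
  (forall k, z k = A (x k) + B (u k)) ->
  synthesis z w = A (synthesis x w) + B (synthesis u w).
Proof.
move=> Ab Bb xb ub zE; apply: cvg_lim; first exact: norm_hausdorff.
have -> : series (fun k => w k *: z k) =
    fun n => A (series (fun k => w k *: x k) n) + B (series (fun k => w k *: u k) n).
  apply/funext => n; rewrite /series/= !linear_sum -big_split/=.
  by apply: eq_bigr => k _; rewrite zE scalerDr !linearZ.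
by apply: cvgD; apply: bounded_op_cvg => //; exact: synthesis_cvg.
Qed.

(** By the conjugation in [l2_of_seq], the partial sums of [synthesis u w] are those of
    [l2_inner w v] times the unit vector [e]. Contraposed: a [w] outside the orthogonal complement
    has nonzero synthesis. *)
Lemma l2_inner_synthesis (R : realType) (U : hilbertType R) (e : U)
    (u : nat -> U) (v w : l2 R) : `|e| = 1 ->
  (forall x : U, exists c : R[i], x = c *: e) -> bessel u -> l2_of_seq e u v ->
  synthesis u w = 0 -> l2_inner w v = 0.
Proof.
move=> e1 e_span ub vE uw0.
have ne : rnorm e = 1 by rewrite /rnorm e1.
have uE k : u k = (v k)^* *: e.
  rewrite vE -inner_conjC; have [c ->] := e_span (u k).
  by rewrite innerZl inner_rnormE ne expr1n mulr1.
have := @synthesis_cvg _ _ _ w ub; rewrite uw0 => /rcvgP uw.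
apply: cvg_lim; first exact: norm_hausdorff.
apply/rcvgP => eps /uw[N uN]; exists N => n /uN.
rewrite !sub0r !rnormvN; apply: le_trans.
rewrite [X in _ <= rnorm X](_ : _ = series (fun k => w k * (v k)^*) n *: e).
  by rewrite rnormvZ ne mulr1.
by rewrite /series/= scaler_suml; apply: eq_bigr => k _; rewrite {1}uE scalerA.
Qed.

(** * Two existence results: orthogonal vectors and linear right inverses *)

(** For x outside the closure, a sequence in [M] minimizing the distance to x is Cauchy by the
    parallelogram law; x minus its limit is orthogonal to [M]. *)
Lemma orthogonal_not_dense (R : realType) (X : hilbertType R) (M : set X) :
  M 0 -> (forall a x y, M x -> M y -> M (a *: x + y)) -> closure M <> setT ->
  exists2 z : X, z != 0 & forall m, M m -> inner m z = 0.
Proof.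
move=> M0 Mlin Mnd.
have [x xM] : exists x, ~ closure M x.
  by apply/existsNP => h; apply: Mnd; apply/seteqP; split.
pose D := [set rnorm (x - m) ^+ 2 | m in M].
have D_inf : has_inf D.
  by split; [exists (rnorm (x - 0) ^+ 2), 0|exists 0 => _ [m _ <-]; exact: sqr_ge0].
pose d := inf D.
have d_le m : M m -> d <= rnorm (x - m) ^+ 2.
  by move=> Mm; apply: ge_inf; [case: D_inf|exists m].
have /choice[m mP] : forall n : nat,
    exists m, M m /\ rnorm (x - m) ^+ 2 < d + n.+1%:R^-1.
  move=> n; have n0 : 0 < n.+1%:R^-1 :> R by rewrite invr_gt0.
  by have [_ [m Mm <-] h] := inf_adherent n0 D_inf; exists m.
have inv_small (eps : R) : 0 < eps ->
    exists N, forall n, (N <= n)%N -> n.+1%:R^-1 <= eps.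
  move=> eps0; exists (Num.truncn eps^-1) => n Nn.
  rewrite invf_ple ?posrE// ltW// (lt_le_trans (truncnS_gt _))// ler_nat ltnS//.
have m_cvg : cvgn m.
  apply: rcauchy_cvg => eps eps0.
  (* The parallelogram law will bound |m_N - m_n|^2 by 2/(N+1) + 2/(n+1), whence the quarter of
     eps^2. *)
  have e4 : 0 < eps ^+ 2 / 4 by rewrite divr_gt0// exprn_gt0.
  have [N NP] := inv_small _ e4.
  exists N => n Nn.
  rewrite -(ler_pXn2r (ltn0Sn 1)) ?nnegrE ?rnormv_ge0 ?(ltW eps0)//.
  have [MN mN] := mP N; have [Mn mn] := mP n.
  have := parallelogram (x - m n) (x - m N).
  have -> : x - m n - (x - m N) = m N - m n by rewrite opprB addrC addrA subrK.
  (* The midpoint is at squared distance at least [d] from x; the trailing 0 lets [Mlin] apply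
     twice. *)
  have Mmid : M (2^-1 *: m n + (2^-1 *: m N + 0)) by do 2 apply: (Mlin) => //.
  have := d_le _ Mmid.
  have -> : x - m n + (x - m N) = 2%:R *: (x - (2^-1 *: m n + (2^-1 *: m N + 0))).
    rewrite addr0 scalerBr scalerDr !scalerA divff ?pnatr_eq0// !scale1r.
    by rewrite scaler_nat mulr2n opprD addrACA.
  rewrite rnormvZ rnorm_nat exprMn; have := NP _ Nn; have := NP _ (leqnn N).
  move: mN mn; set a := N.+1%:R^-1; set b := n.+1%:R^-1.
  move: (rnorm (x - m N) ^+ 2) (rnorm (x - m n) ^+ 2) (rnorm (m N - m n) ^+ 2).
  move: (rnorm (x - _) ^+ 2) => *; lra.
have /rcvgP mp := m_cvg; set p := lim _ in mp.
exists (x - p).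
  rewrite subr_eq0; apply/eqP => xp; apply: xM; apply/closure_rnormP => eps eps0.
  have [N NP] := mp _ (divr_gt0 eps0 (ltr0n _ 2)).
  exists (m N); first by case: (mP N).
  rewrite xp (le_lt_trans (NP _ (leqnn N)))// ltr_pdivrMr// ltr_pMr// ltr1n//.
move=> y My; have [->|y0] := eqVneq y 0; first exact: linear0l.
rewrite inner_conjC; apply/eqP; rewrite conjC_eq0.
suff : rnorm (inner (x - p) y) <= 0.
  move=> h; rewrite -normr_eq0 rnormcE (inj_eq (@complexI R)) eq_le h.
  exact: rnorm_ge0.
apply/ler_addgt0Pl => eps eps0; rewrite addr0.
have ny : 0 < rnorm y by rewrite lt_neqAle rnormv_ge0 eq_sym rnormv_eq0 y0.
(* Two errors of at most delta |y| add up to eps: one as m_n is nearly minimal, one as m_n is near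
   p. *)
pose delta := eps / (2 * rnorm y).
have delta0 : 0 < delta by rewrite divr_gt0// mulr_gt0.
have [N1 N1P] := mp _ delta0.
have [N2 N2P] := inv_small _ (exprn_gt0 2 delta0).
pose n := maxn N1 N2; pose u := x - m n.
have [Mn mn] := mP n.
have -> : x - p = u + (m n - p) by rewrite /u addrA subrK.
rewrite innerDl (le_trans (rnormD _ _))//.
have h1 : rnorm (inner u y) <= delta * rnorm y.
  have dy0 : 0 <= delta * rnorm y := mulr_ge0 (ltW delta0) (ltW ny).
  rewrite -(ler_pXn2r (ltn0Sn 1)) ?nnegrE ?rnorm_ge0//.
  rewrite exprMn -ler_pdivrMr ?exprn_gt0//.
  apply: le_trans (N2P n (leq_maxr _ _)).
  (* The competitor c y + m_n in [M] has squared distance at least [d] from x. By Pythagoras this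
     distance is |u|^2 - q, while |u|^2 < d + r; hence q < r. *)
  have := rnorm_sub_proj u y0; set c := inner u y / _.
  have := d_le _ (Mlin c y (m n) My Mn).
  have -> : x - (c *: y + m n) = u - c *: y by rewrite /u opprD addrA addrAC.
  move: mn; rewrite -/u; set q := _ / rnorm y ^+ 2; set r := n.+1%:R^-1.
  by move: (rnorm u ^+ 2) (rnorm (u - _) ^+ 2) => *; lra.
have h2 : rnorm (inner (m n - p) y) <= delta * rnorm y.
  rewrite (le_trans (Cauchy_Schwarz _ _))// ler_wpM2r ?rnormv_ge0//.
  by rewrite -rnormvN opprB N1P// leq_maxl.
rewrite (le_trans (lerD h1 h2))// -mulr2n -mulr_natl /delta.
by rewrite le_eqVlt; apply/orP; left; apply/eqP; field; rewrite gt_eqF.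
Qed.

(* The values of [g] form a complement of the kernel of [f], which Zorn's
   lemma provides as a maximal subspace meeting the kernel trivially. *)
Lemma linear_right_inverse (K : fieldType) (V W : lmodType K) (f : {linear V -> W}) :
  exists2 g : W -> V, (forall x, range f x -> f (g x) = x) &
    forall a x y, range f x -> range f y -> g (a *: x + y) = a *: g x + g y.
Proof.
pose P (A : set V) := (forall a x y, A x -> A y -> A (a *: x + y)) /\
  (forall x, A x -> f x = 0 -> x = 0).
have [|A [[Alin Aker] Amax]] := @Zorn_bigcup V P.
  move=> F FP Ftot; split=> [a x y [A FA Ax] [B FB By]|x [A FA Ax]]; last first.
    by case: (FP _ FA) => _; apply.
  have [AB|BA] := Ftot _ _ FA FB.
    by exists B => //; apply: (FP _ FB).1 => //; exact: AB.
  by exists A => //; apply: (FP _ FA).1 => //; exact: BA.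
(* The empty set satisfies [P], as the empty chain requires, so 0 in [A] has to come from
   maximality. *)
have A0 : A 0.
  apply: contrapT => nA0; apply: (Amax (A `|` [set 0])).
    split; last by move=> /(_ 0 (or_intror erefl)).
    by move=> x; left.
  split=> [a x y [Ax|->] [Ay|->]|x [Ax|->]//]; last 1 first.
  - by apply: Aker.
  - by left; exact: Alin.
  - left; rewrite addr0; have := Alin (a - 1) x x Ax Ax.
    by rewrite scalerBl scale1r subrK.
  - by left; rewrite scaler0 add0r.
  - by right; rewrite scaler0 addr0.
have Af v : exists2 s, A s & f s = f v.
  apply: contrapT => nv.
  (* If f v were missed, the span of [A] and v would still meet the kernel trivially, against
     maximality. *)
  apply: (Amax [set w | exists a s, A s /\ w = a *: v + s]).
    split=> [s As|h]; first by exists 0, s; rewrite scale0r add0r.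
    apply: nv; exists v => //; apply: h; exists 1, 0.
    by rewrite scale1r addr0.
  split=> [a _ _ [b [s [As ->]]] [c [t [At ->]]]|_ [a [s [As ->]]] fas].
    exists (a * b + c), (a *: s + t); split; first exact: Alin.
    by rewrite scalerDr scalerA scalerDl addrACA.
  have [a0|a0] := eqVneq a 0.
    by rewrite a0 scale0r add0r in fas *; exact: Aker.
  exfalso; apply: nv; exists (- a^-1 *: s).
    by rewrite -[X in A X]addr0; exact: Alin.
  apply: (scalerI a0); rewrite -linearZ scalerA mulrN divff// scaleN1r linearN.
  by apply/eqP; rewrite eq_sym -subr_eq0 opprK -linearZ -linearD fas.
have /choice[g gP] (x : W) : exists s, range f x -> A s /\ f s = x.
  (* Outside the range of f, 0 is a mere default value. *)
  have [[v _ <-]|nx] := pselect (range f x); last by exists 0.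
  by have [s As fs] := Af v; exists s.
exists g => [x fx|a x y fx fy]; first exact: (gP x fx).2.
have fxy : range f (a *: x + y).
  have [[v _ <-] [w _ <-]] := (fx, fy).
  by exists (a *: v + w) => //; rewrite linearP.
have [[[Ax Ex] [Ay Ey]] [Axy Exy]] := (gP _ fx, gP _ fy, gP _ fxy).
apply/eqP; rewrite -subr_eq0; apply/eqP; apply: Aker.
  by rewrite addrC -scaleN1r; exact: Alin _ _ _ (Alin _ _ _ Ax Ay) Axy.
by rewrite linearB linearP Exy Ex Ey subrr.
Qed.

(** * Sums, multiples and composites of bounded operators *)

Section bounded_op_closure.
Variable R : realType.
Implicit Types Y Z W : normedModType R[i].

Lemma bounded_opD Y Z (F G : Y -> Z) :
  bounded_op F -> bounded_op G -> bounded_op (fun y => F y + G y).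
Proof.
move=> [C FC] [D GD]; exists (C + D) => y.
by rewrite (le_trans (rnormvD _ _))// mulrDl lerD.
Qed.

Lemma bounded_opZ Y Z (a : R[i]) (F : Y -> Z) :
  bounded_op F -> bounded_op (fun y => a *: F y).
Proof.
move=> [C FC]; exists (rnorm a * C) => y.
by rewrite rnormvZ -mulrA ler_wpM2l// rnorm_ge0.
Qed.

Lemma bounded_op_comp Y Z W (F : Z -> W) (G : Y -> Z) :
  bounded_op F -> bounded_op G -> bounded_op (fun y => F (G y)).
Proof.
move=> /bounded_op_pos[C C0 FC] [D GD]; exists (C * D) => y.
by rewrite (le_trans (FC _))// -mulrA ler_wpM2l// ltW.
Qed.

Lemma bounded_op0 Y Z : bounded_op (fun _ : Y => 0 : Z).
Proof. by exists 0 => y; rewrite rnormv0 mul0r. Qed.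

End bounded_op_closure.

(** * Consequences of informativity for stabilization *)

Section informativity.
Variables (R : realType) (X U : hilbertType R).
Variables (As : {linear X -> X}) (Bs : {linear U -> X}).
Hypotheses (As_bounded : bounded_op As) (Bs_bounded : bounded_op Bs).
Variables (x1 x0 : nat -> X) (u0 : nat -> U).
Hypothesis data_eq : forall k, x1 k = As (x0 k) + Bs (u0 k).

(* All the systems (As + n A, Bs + n B) explain the data, so the closed-loop
   operators As + Bs K + n (A + B K) are bounded uniformly in n. *)
Lemma stabilized_homogeneous (K : {linear X -> U}) (M gamma : R)
    (A : {linear X -> X}) (B : {linear U -> X}) :
  bounded_op K -> Sigma_is x1 x0 u0 `<=` Sigma_stab K M gamma ->
  bounded_op A -> bounded_op B -> (forall k, A (x0 k) + B (u0 k) = 0) ->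
  forall x, A x + B (K x) = 0.
Proof.
move=> Kb stab Ab Bb AB0 x.
have bound n : n%:R * rnorm (A x + B (K x)) <=
    M * gamma * rnorm x + rnorm (As x + Bs (K x)).
  pose An : {linear X -> X} := As \+ ((n%:R : R[i]) \*: A).
  pose Bn : {linear U -> X} := Bs \+ ((n%:R : R[i]) \*: B).
  (* The exponent 1 in the stability bound controls the closed loop itself. *)
  have [|_ _ /(_ 1%N)/=] := stab (An, Bn).
    split=> [||k]; [exact/bounded_opD/bounded_opZ|exact/bounded_opD/bounded_opZ|].
    by rewrite /= addrACA -scalerDr AB0 scaler0 addr0.
  rewrite expr1 => h.
  pose Fn : {linear X -> X} := An \+ (Bn \o K).
  have Fnb : bounded_op Fn.
    apply: bounded_opD; first exact/bounded_opD/bounded_opZ.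
    by apply: bounded_op_comp => //; exact/bounded_opD/bounded_opZ.
  have Fn_le : rnorm (Fn x) <= M * gamma * rnorm x.
    by rewrite (le_trans (opnorm_ge x Fnb))// ler_wpM2r// rnormv_ge0.
  rewrite -(rnorm_nat R n) -rnormvZ.
  have -> : n%:R *: (A x + B (K x)) = Fn x - (As x + Bs (K x)).
    by rewrite /Fn /An /Bn /= addrACA -scalerDr [RHS]addrC addKr.
  by rewrite (le_trans (rnormvD _ _))// rnormvN lerD2r.
apply/eqP; rewrite -rnormv_eq0; apply: contraT => Gx.
have G0 : 0 < rnorm (A x + B (K x)) by rewrite lt_neqAle rnormv_ge0 eq_sym Gx.
move: bound; set c := _ + rnorm (As x + _) => bound.
(* An integer beyond c divided by the norm violates [bound]. *)
have := bound (Num.truncn (c / rnorm (A x + B (K x)))).+1.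
by rewrite -ler_pdivlMr// leNgt truncnS_gt.
Qed.

Lemma stabilized_dense (K : {linear X -> U}) (M gamma : R) :
  bessel x0 -> bounded_op K -> Sigma_is x1 x0 u0 `<=` Sigma_stab K M gamma ->
  closure (range (synthesis x0)) = setT.
Proof.
move=> x0b Kb stab; apply: contrapT => nd.
have lin := synthesis_linear x0b.
have [||z z0 zP] := orthogonal_not_dense _ _ nd.
- exists 0 => //; rewrite -[RHS](subrr (synthesis x0 0)) -scaleN1r addrC -lin.
  by rewrite scaler0 addr0.
- by move=> a _ _ [v _ <-] [w _ <-]; exists (a *: v + w) => //; exact: lin.
have [|A AE] := @linear_bundle _ _ _ (fun x : X => inner x z *: z).
  by move=> a x y; rewrite innerDl innerZl scalerDl scalerA.
have Ab : bounded_op A.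
  exists (rnorm z * rnorm z) => y.
  rewrite AE rnormvZ mulrAC ler_wpM2r ?rnormv_ge0// mulrC.
  exact: Cauchy_Schwarz.
pose B : {linear U -> X} := \0; have Bb : bounded_op B := bounded_op0 U X.
(* Each x0 k is the synthesis of a unit vector, hence orthogonal to z. *)
have A0 k : A (x0 k) + B (u0 k) = 0.
  rewrite /= addr0 AE zP ?scale0r//.
  by exists (L2 (delta_l2 R k)) => //; exact: synthesis_delta.
have /eqP := stabilized_homogeneous Kb stab Ab Bb A0 z.
rewrite /= addr0 AE scaler_eq0 (negbTE z0) orbF inner_rnormE.
by rewrite (inj_eq (@complexI R)) expf_eq0 rnormv_eq0 (negbTE z0) andbF.
Qed.

(* A competing system differs from (As, Bs) by some (A, B) with A = - B K, so
   B (u0 - K x0) = 0; as dim U = 1 and B is nonzero, B is injective. *)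
Lemma noninformative_feedback (K : {linear X -> U}) (M gamma : R) (e : U) :
  (forall u : U, exists c : R[i], u = c *: e) ->
  bounded_op K -> Sigma_is x1 x0 u0 `<=` Sigma_stab K M gamma ->
  ~ informative_identification x1 x0 u0 As Bs ->
  forall k, u0 k = K (x0 k).
Proof.
move=> e_span Kb stab ninf k.
have [[A1 B1] [[/= A1b B1b AB1] AB1ne]] :
    exists AB, Sigma_is x1 x0 u0 AB /\ AB <> (As, Bs).
  apply: contrapT => nAB; apply: ninf; apply/seteqP; split => [AB ABis|_ ->].
    by apply: contrapT => ne; apply: nAB; exists AB.
  by split.
pose A : {linear X -> X} := A1 \+ ((-1 : R[i]) \*: As).
pose B : {linear U -> X} := B1 \+ ((-1 : R[i]) \*: Bs).
have AB0 j : A (x0 j) + B (u0 j) = 0.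
  by rewrite /A /B /= addrACA -AB1 -scalerDr -data_eq scaleN1r subrr.
have Ab : bounded_op A := bounded_opD A1b (bounded_opZ (-1) As_bounded).
have Bb : bounded_op B := bounded_opD B1b (bounded_opZ (-1) Bs_bounded).
have ABK := stabilized_homogeneous Kb stab Ab Bb AB0.
(* B e = 0 would force B = 0 and then A = - B K = 0, making the competitor equal to (As, Bs). *)
have [Be|Be] := eqVneq (B e) 0.
  have B0 u : B u = 0 by have [c ->] := e_span u; rewrite linearZ_LR Be scaler0.
  have A0 x : A x = 0 by have := ABK x; rewrite -/A -/B B0 addr0.
  exfalso; apply: AB1ne; congr pair; apply: linear_extP => y;
    apply/eqP; rewrite -subr_eq0 -scaleN1r; apply/eqP; first exact: A0.
  exact: B0.
have : B (u0 k - K (x0 k)) = 0.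
  rewrite linearB; apply/eqP; rewrite subr_eq0 -(can_eq (addrK (A (x0 k)))).
  by rewrite addrC AB0 addrC ABK.
have [c cE] := e_span (u0 k - K (x0 k)).
rewrite cE linearZ => /eqP; rewrite scaler_eq0 (negbTE Be) orbF => /eqP c0.
by apply/eqP; rewrite -subr_eq0 cE c0 scale0r.
Qed.

End informativity.

Theorem corollary4p2 (R : realType) (X U : hilbertType R)
    (X_nontrivial : exists x : X, x != 0)
    (e : U) (e_unit : `|e| = 1)
    (U_dim1 : forall u : U, exists c : R[i], u = c *: e)
    (As : {linear X -> X}) (Bs : {linear U -> X})
    (As_bounded : bounded_op As) (Bs_bounded : bounded_op Bs)
    (x1 x0 : nat -> X) (u0 : nat -> U)
    (x1_bessel : bessel x1) (x0_bessel : bessel x0) (u0_bessel : bessel u0)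
    (data_eq : forall k, x1 k = As (x0 k) + Bs (u0 k))
    (u0_l2 : l2 R) (u0_l2E : l2_of_seq e u0 u0_l2)
    (Xi1 := synthesis x1) (Xi0 := synthesis x0) (Upsilon0 := synthesis u0)
    (ker_or_noninformative :
      Ker Xi0 `\` l2_orthocompl [set u0_l2] !=set0 \/
      ~ informative_identification x1 x0 u0 As Bs)
    (gamma : R) (gamma_gt0 : 0 < gamma) (gamma_lt1 : gamma < 1) :
  informative_stabilization x1 x0 u0 gamma <->
  closure (range Xi0) = setT /\
  exists Xi0d : partial_op X (l2 R),
    [/\ densely_defined Xi0d,
        pdom Xi0d = range Xi0,
        (forall x, pdom Xi0d x -> Xi0 (pfun Xi0d x) = x),
        (exists2 K : {linear X -> U}, bounded_op K &
          forall x, pdom Xi0d x -> K x = Upsilon0 (pfun Xi0d x)) &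
        (exists F : {linear X -> X},
          [/\ bounded_op F,
              (forall x, pdom Xi0d x -> F x = Xi1 (pfun Xi0d x)) &
              power_stable gamma F])].
Proof.
have Xi0l := synthesis_linear x0_bessel; have Ul := synthesis_linear u0_bessel.
have [Xi0L Xi0E] := linear_bundle Xi0l.
split=> [[K [Kb [M M1 stab]]]|[_ [Xi0d [Xi0d_dense domE Xi0dK [K Kb KE]
  [F [Fb FE [M M1 Fstab]]]]]]].
  have Rdense := stabilized_dense As_bounded Bs_bounded data_eq x0_bessel Kb stab.
  split=> //.
  have Rlin a x y : range Xi0 x -> range Xi0 y -> range Xi0 (a *: x + y).
    by move=> [v _ <-] [w _ <-]; exists (a *: v + w) => //; exact: Xi0l.
  have R0 : range Xi0 0 by exists 0; rewrite // /Xi0 -Xi0E linear0.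
  have [g gK glin] : exists2 g : X -> l2 R, (forall x, range Xi0 x -> Xi0 (g x) = x) &
      forall a x y, range Xi0 x -> range Xi0 y -> g (a *: x + y) = a *: g x + g y.
    have [g] := linear_right_inverse Xi0L.
    by rewrite (funext Xi0E); exists g.
  (* [E] will be the right inverse sought; the last property makes K itself the bounded extension of
     [Upsilon0] after [E]. *)
  have [E [EK Elin UE0]] : exists E : X -> l2 R,
      [/\ forall x, range Xi0 x -> Xi0 (E x) = x,
          forall a x y, range Xi0 x -> range Xi0 y -> E (a *: x + y) = a *: E x + E y &
          forall x, range Xi0 x -> K x = Upsilon0 (E x)].
    case: ker_or_noninformative => [[w [Kw nw]]|ninf]; last first.
      exists g; split=> // x Rx.
      have u0E :=
        noninformative_feedback As_bounded Bs_bounded data_eq U_dim1 Kb stab ninf.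
      (* As u0 k = K (x0 k), [synthesis_comb] with a zero second operator yields Upsilon0 = K
         Xi0. *)
      pose B : {linear X -> U} := \0.
      have Bb : bounded_op B := bounded_op0 X U.
      rewrite -[in LHS](gK _ Rx) /Upsilon0.
      rewrite (synthesis_comb (g x) Kb Bb x0_bessel x0_bessel (z := u0)) ?addr0// => k.
      by rewrite addr0.
    have [c cE] := U_dim1 (Upsilon0 w).
    have c0 : c != 0.
      apply/eqP => c0; apply: nw => v ->.
      apply: (l2_inner_synthesis e_unit U_dim1 u0_bessel u0_l2E).
      by rewrite -/Upsilon0 cE c0 scale0r.
    (* The coefficient for which Upsilon0 (phi x w) is the defect K x - Upsilon0 (g x), read off
       along e. Since w lies in the kernel, adding phi x w leaves Xi0 (g x) unchanged. *)
    pose phi x := inner (K x - Upsilon0 (g x)) e / c.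
    have nE : rnorm e = 1 by rewrite /rnorm e_unit.
    exists (fun x => phi x *: w + g x); split=> [x Rx|a x y Rx Ry|x Rx].
    - by rewrite /Xi0 Xi0l -/Xi0 Kw scaler0 add0r gK.
    - have -> : phi (a *: x + y) = a * phi x + phi y.
        rewrite /phi glin// linearP /Upsilon0 Ul -/Upsilon0.
        by rewrite opprD addrACA -scalerBr innerDl innerZl mulrDl mulrA.
      by rewrite glin// scalerDl scalerDr scalerA addrACA.
    - rewrite /Upsilon0 Ul -/Upsilon0 cE scalerA /phi divfK//.
      have [b bE] := U_dim1 (K x - Upsilon0 (g x)).
      by rewrite bE innerZl inner_rnormE nE expr1n mulr1 -bE subrK.
  exists (PartialOp R0 Rlin Elin); split=> //=; first by exists K.
  (* On the range, Xi1 E = As Xi0 E + Bs Upsilon0 E = As + Bs K. As (As, Bs) explains the data, this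
     operator is power stable. *)
  exists (As \+ (Bs \o K)); split => [|x Rx /=|].
  - exact: bounded_opD As_bounded (bounded_op_comp Bs_bounded Kb).
  - rewrite /Xi1.
    rewrite (synthesis_comb _ As_bounded Bs_bounded x0_bessel u0_bessel data_eq).
    by rewrite -/Xi0 EK// UE0.
  - by have [|_ _ h] := stab (As, Bs); [split|exists M].
(* The extension K of Upsilon0 Xi0d is the feedback, and the constant of F serves every system at
   once. *)
exists K; split=> //; exists M => // -[A B] [/= Ab Bb ABE].
have FE2 : (fun x => A x + B (K x)) = F.
  pose G : {linear X -> X} := A \+ (B \o K) \+ ((-1 : R[i]) \*: F).
  have Gb : bounded_op G.
    exact: bounded_opD (bounded_opD Ab (bounded_op_comp Bb Kb)) (bounded_opZ _ Fb).
  have G0 := bounded_op_dense_eq0 Xi0d_dense Gb.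
  apply/funext => x; apply/eqP; rewrite -subr_eq0 -scaleN1r; apply/eqP.
  apply: G0 => y Dy; rewrite /G /= scaleN1r FE// KE//.
  rewrite /Xi1 (synthesis_comb _ Ab Bb x0_bessel u0_bessel ABE) -/Xi0 Xi0dK//.
  by rewrite subrr.
by split=> //= k; rewrite FE2.
Qed.
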